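(* Let $q$ be a prime power. The map $P\mapsto(P_\sigma)_{\sigma\in\Sigma}$, where $P_\sigma$ is the restriction of $P$ to $\mathbb L^\sigma(q)$ (so that $P=\sum_{\sigma\in\Sigma}P_\sigma$), is an affine isomorphism of convex cones $$\mathcal P^{GL(\infty,q)}\cong\prod_{\sigma\in\Sigma}\mathcal P^{GL(\infty,q)}_\sigma .$$
   Context: $\mathfrak{gl}(n,q)=\mathrm{Mat}_n(\mathbb F_q)$; $GL(\infty,q)=\varinjlim GL(n,q)$ (embedding $g\mapsto\mathrm{diag}(g,1)$). For $n\ge0$, $\mathbb L_n(q)$ is the set of infinite matrices $M=[m_{i,j}]_{i,j\ge1}$ over $\mathbb F_q$ with $m_{i,j}=0$ whenever $i\ge j$ and $i>n$, with the (compact) topology of entrywise convergence. $\mathbb L(q)=\bigcup_{n\ge0}\mathbb L_n(q)$ has the inductive limit topology (each $\mathbb L_n(q)$ is compact and open); $GL(\infty,q)$ acts on it by conjugation. $M^{\{n\}}$ denotes the upper-left $n\times n$ corner of $M$. For $s\ge0$, $\Sigma_s$ is the set of $GL(s,q)$-conjugacy classes of nonsingular matrices in $\mathfrak{gl}(s,q)$ ($\Sigma_0$ is a singleton), and $\Sigma=\bigsqcup_{s\ge0}\Sigma_s$. For $X\in\mathfrak{gl}(n,q)$, let $\mathbb F_q^n=V'\oplus V_0$ be the unique $X$-invariant decomposition with $X|_{V'}$ invertible and $X|_{V_0}$ nilpotent; the nonsingular type of $X$ is the class in $\Sigma_{\dim V'}$ of $X|_{V'}$. For $M\in\mathbb L(q)$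 the nonsingular type of $M^{\{n\}}$ is constant for all sufficiently large $n$; this stable value is denoted $\sigma(M)$. Put $\mathbb L^\sigma(q)=\{M\in\mathbb L(q):\sigma(M)=\sigma\}$; these are nonempty, $GL(\infty,q)$-invariant clopen sets partitioning $\mathbb L(q)$. A Radon measure is a nonnegative Borel measure finite on compact sets. $\mathcal P^{GL(\infty,q)}$ is the convex cone of $GL(\infty,q)$-invariant Radon measures on $\mathbb L(q)$, and $\mathcal P_\sigma^{GL(\infty,q)}$ is the subcone of those supported on $\mathbb L^\sigma(q)$ (vanishing outside it). An affine isomorphism of convex cones is a bijection preserving sums and multiplication by nonnegative reals; the product is the full direct product. *)

(* Defs.v *)
From HB Require Import structures.
From mathcomp Require Import all_boot all_order all_algebra.
From mathcomp Require Import all_classical all_reals all_analysis.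

Set Implicit Arguments.
Unset Strict Implicit.
Unset Printing Implicit Defensive.
Import Order.TTheory GRing.Theory Num.Theory.
Import numFieldNormedType.Exports.
Local Open Scope classical_set_scope.
Local Open Scope ring_scope.

(* Indices start at 0 instead of 1 throughout: the entry m_{i,j} of M is
   M (i-1, j-1).  The field with q elements is an arbitrary finFieldType. *)

Definition infmx (F : finFieldType) : Type :=
  prod_topology (fun _ : nat * nat => discrete_topology F).
HB.instance Definition _ (F : finFieldType) := Topological.on (infmx F).

Section InfiniteMatrices.
Context {F : finFieldType}.
Implicit Types (M : infmx F).

Definition corner (n : nat) M : 'M[F]_n := \matrix_(i, j) (M (val i, val j) : F).

(* The sum has finite support whenever A is row-finite or B is column-finite. *)
Definition infmul (A B : infmx F) : infmx F :=
  fun ij => \sum_(k \in [set: nat]) (A (ij.1, k) : F) * (B (k, ij.2) : F).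

(* diag(g, 1, 1, ...): GL(oo, q) is the union over n of the images of
   GL(n, q) under this embedding. *)
Definition diag_embed (n : nat) (g : 'M[F]_n) : infmx F :=
  fun ij => if (insub ij.1, insub ij.2) is (Some i, Some j) then g i j
            else (ij.1 == ij.2)%:R.

Definition infconj (n : nat) (g : 'M[F]_n) M : infmx F :=
  infmul (infmul (diag_embed g) M) (diag_embed (invmx g)).

Definition Lset (n : nat) : set (infmx F) :=
  [set M | forall i j : nat, (j <= i)%N -> (n <= i)%N -> M (i, j) = 0 :> F].

End InfiniteMatrices.

Arguments Lset F n : clear implicits.

Definition Lq (F : finFieldType) : Type := set_type (\bigcup_n Lset F n).
HB.instance Definition _ (F : finFieldType) := Choice.on (Lq F).

Section SpaceL.
Context {F : finFieldType}.

Definition mkL (n : nat) (M : infmx F) (LM : Lset F n M) : Lq F :=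
  exist _ M (mem_set (ex_intro2 _ _ n I LM)).

Lemma LsetP (M : Lq F) : exists n, Lset F n (val M).
Proof. by case: M => M /= /set_mem[n _ LM]; exists n. Qed.

Definition Lincl (n : nat) (M : set_type (Lset F n)) : Lq F :=
  mkL (set_mem (valP M)).

(* Inductive limit topology; each Lset F n carries the subtype topology
   inherited from the product of discrete spaces. *)
Definition Lopen : set (set (Lq F)) :=
  [set U | forall n, open (@Lincl n @^-1` U)].

Let LopenT : Lopen setT.
Proof. by move=> n; rewrite preimage_setT; exact: openT. Qed.

Let LopenI : setI_closed Lopen.
Proof. by move=> A B oA oB n; rewrite preimage_setI; exact: openI. Qed.

Let Lopen_bigU (I : Type) (f : I -> set (Lq F)) :
  (forall i, Lopen (f i)) -> Lopen (\bigcup_i f i).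
Proof.
by move=> of_ n; rewrite preimage_bigcup; apply: bigcup_open => i _; exact: of_.
Qed.

HB.instance Definition _ := isOpenTopological.Build (Lq F) LopenT LopenI Lopen_bigU.

Let Lzero : Lset F 0 (fun=> 0 : F). Proof. by []. Qed.
HB.instance Definition _ := isPointed.Build (Lq F) (mkL Lzero).

HB.instance Definition _ := @isMeasurable.Build (sigma_display (@open (Lq F)))
  (Lq F) <<s @open (Lq F) >> (@sigma_algebra0 _ setT _)
  (@sigma_algebraC (Lq F) _) (@sigma_algebra_bigcup _ setT _).

End SpaceL.

Section Conj.
Context {F : finFieldType}.

Lemma infmul_ord N (A B : infmx F) i j :
    (forall k, (N <= k)%N -> (A (i, k) : F) * (B (k, j) : F) = 0) ->
  infmul A B (i, j) = \sum_(k < N) (A (i, val k) : F) * (B (val k, j) : F).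
Proof.
move=> AB0; rewrite /infmul /= (fsbig_ord _ _ (fun k => (A (i, k) : F) * (B (k, j) : F))).
symmetry; apply: fsbig_widen => // k [_ /negP]; rewrite -leqNgt; exact: AB0.
Qed.

Lemma infmul_diagl n (g : 'M[F]_n) (M : infmx F) i j :
  infmul (diag_embed g) M (i, j) =
  if insub i is Some i' then \sum_(k < n) g i' k * (M (val k, j) : F)
  else M (i, j).
Proof.
case: insubP => [i' /= _ <-|/negbTE ni] /=.
  rewrite (@infmul_ord n) => [|k nk].
    by apply: eq_bigr => k _; rewrite /diag_embed /= !valK.
  rewrite /diag_embed /= valK insubF ?ltnNge ?nk //.
  by rewrite ltn_eqF ?mul0r // (leq_trans (ltn_ord i')).
rewrite (@infmul_ord i.+1) => [|k ik].
  rewrite big_ord_recr /= big1 => [|k _]; last first.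
    by rewrite /diag_embed /= insubF // gtn_eqF ?mul0r.
  by rewrite /diag_embed /= insubF // eqxx mul1r add0r.
by rewrite /diag_embed /= insubF // ltn_eqF ?mul0r.
Qed.

Lemma infmul_diagr n (g : 'M[F]_n) (M : infmx F) i j :
  infmul M (diag_embed g) (i, j) =
  if insub j is Some j' then \sum_(k < n) (M (i, val k) : F) * g k j'
  else M (i, j).
Proof.
case: insubP => [j' /= _ <-|/negbTE nj] /=.
  rewrite (@infmul_ord n) => [|k nk].
    by apply: eq_bigr => k _; rewrite /diag_embed /= !valK.
  rewrite /diag_embed /= [insub k]insubF ?ltnNge ?nk //.
  by rewrite gtn_eqF ?mulr0 // (leq_trans (ltn_ord j')).
have De (k : nat) : diag_embed g (k, j) = (k == j)%:R :> F.
  by rewrite /diag_embed /= [insub j]insubF //; case: insub.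
rewrite (@infmul_ord j.+1) => [|k jk].
  rewrite big_ord_recr /= big1 => [|k _]; last by rewrite De ltn_eqF ?mulr0.
  by rewrite De eqxx mulr1 add0r.
by rewrite De gtn_eqF ?mulr0.
Qed.

Lemma infconj_Lset n (g : 'M[F]_n) m (M : infmx F) :
  Lset F m M -> Lset F (maxn m n) (infconj g M).
Proof.
move=> LM i j ji; rewrite geq_max => /andP[mi ni].
rewrite /infconj infmul_diagr; case: insubP => [j' _ _|_].
  rewrite big1 // => k _; rewrite infmul_diagl insubF ?ltnNge ?ni //.
  by rewrite LM ?mul0r //; apply/ltnW/(leq_trans (ltn_ord k)).
by rewrite infmul_diagl insubF ?ltnNge ?ni //; exact: LM.
Qed.

Lemma infconj_closed n (g : 'M[F]_n) (M : Lq F) :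
  infconj g (val M) \in \bigcup_m Lset F m.
Proof.
have [m LM] := LsetP M.
by apply/mem_set; exists (maxn m n) => //; exact: infconj_Lset.
Qed.

Definition Lconj n (g : 'M[F]_n) (M : Lq F) : Lq F :=
  exist _ (infconj g (val M)) (infconj_closed g M).
End Conj.

Definition conj_class (F : finFieldType) (s : nat) (X : 'M[F]_s) : {set 'M[F]_s} :=
  [set g *m X *m invmx g | g in [set g : 'M[F]_s | g \in unitmx]]%SET.

Definition Sigma_ (F : finFieldType) (s : nat) : Type :=
  {C : {set 'M[F]_s} |
   C \in [set conj_class X | X in [set X : 'M[F]_s | X \in unitmx]]%SET}.
HB.instance Definition _ (F : finFieldType) s := Finite.on (Sigma_ F s).

Definition Sigma (F : finFieldType) : Type := {s : nat & Sigma_ F s}.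
HB.instance Definition _ (F : finFieldType) := Countable.on (Sigma F).

Section NonsingularType.
Context {F : finFieldType}.

Lemma mem_Sigma_ (s : nat) (A : 'M[F]_s) : A \in unitmx ->
  conj_class A \in [set conj_class X | X in [set X : 'M[F]_s | X \in unitmx]]%SET.
Proof. by move=> uA; apply: imset_f; rewrite inE. Qed.

Lemma conj_classP (s : nat) (A B : 'M[F]_s) :
  reflect (exists2 g, g \in unitmx & B *m g = g *m A) (B \in conj_class A).
Proof.
apply: (iffP imsetP) => [[g]|[g ug BgA]].
  by rewrite inE => ug ->; exists g => //; rewrite mulmxKV.
by exists g; rewrite ?inE // -BgA mulmxK.
Qed.

Lemma conj_class_eq (s : nat) (A B : 'M[F]_s) :
  B \in conj_class A -> conj_class B = conj_class A.
Proof.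
move=> /conj_classP[g ug BgA]; apply/setP => C.
apply/conj_classP/conj_classP => -[h uh ChB].
  by exists (h *m g); rewrite ?unitmx_mul ?uh // mulmxA ChB -!mulmxA BgA.
exists (h *m invmx g); first by rewrite unitmx_mul uh unitmx_inv.
rewrite mulmxA ChB -!mulmxA; congr (_ *m _).
by rewrite -[B](mulmxK ug) BgA !mulmxA mulVmx // mul1mx.
Qed.

Definition class_of_unit (s : nat) (A : 'M[F]_s) (uA : A \in unitmx) : Sigma F :=
  Tagged (Sigma_ F) (exist _ (conj_class A) (mem_Sigma_ uA) : Sigma_ F s).

(* The unique element of Sigma_0; serves as default value only. *)
Definition Sigma0 : Sigma F := class_of_unit (unitmx1 F 0).

(* The columns of V and V0 are bases of the X-invariant subspaces V' and V_0 of
   F^n; A and N are the matrices of the restrictions of X in these bases. *)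
Definition nonsingular_part (n : nat) (X : 'M[F]_n) (s : nat) (A : 'M[F]_s) : Prop :=
  exists (t : nat) (V : 'M[F]_(n, s)) (V0 : 'M[F]_(n, t)) (N : 'M[F]_t),
    [/\ (s + t)%N = n /\ \rank (row_mx V V0) = n,
        X *m V = V *m A, X *m V0 = V0 *m N,
        A \in unitmx & exists k, N ^+ k = 0].

Definition has_nonsingular_type (n : nat) (X : 'M[F]_n) (tau : Sigma F) : Prop :=
  exists2 A : 'M[F]_(tag tau), A \in val (tagged tau) & nonsingular_part X A.

Definition nonsingular_type (n : nat) (X : 'M[F]_n) : Sigma F :=
  xget Sigma0 (has_nonsingular_type X).

Lemma mulmx_exp n s k (X : 'M[F]_n) (V : 'M[F]_(n, s)) (A : 'M[F]_s) :
  X *m V = V *m A -> X ^+ k *m V = V *m A ^+ k.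
Proof.
move=> XV; elim: k => [|k IH]; first by rewrite !expr0 mul1mx mulmx1.
by rewrite exprSr -mulmxE -mulmxA XV mulmxA IH -mulmxA mulmxE -exprSr.
Qed.

Lemma unitmx_exp s k (A : 'M[F]_s) : A \in unitmx -> A ^+ k \in unitmx.
Proof.
move=> uA; elim: k => [|k IH]; first by rewrite expr0 unitmx1.
by rewrite exprS -mulmxE unitmx_mul uA.
Qed.

Lemma col_free_inj n s p (V : 'M[F]_(n, s)) (B C : 'M[F]_(s, p)) :
  \rank V = s -> V *m B = V *m C -> B = C.
Proof.
move=> rV VBC; have /mulVpmx VV : row_full V by rewrite /row_full rV.
by rewrite -[B]mul1mx -[C]mul1mx -VV -!mulmxA VBC.
Qed.

Lemma col_freeP n s (V : 'M[F]_(n, s)) :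
  (forall B : 'M[F]_s, V *m B = 0 -> B = 0) -> \rank V = s.
Proof.
move=> inj; rewrite -mxrank_tr; apply/eqP; rewrite -/(row_free _) -kermx_eq0.
rewrite -[kermx _]trmxK trmx_eq0; apply/eqP/inj.
by apply: trmx_inj; rewrite trmx_mul trmxK mulmx_ker trmx0.
Qed.

Lemma nonsingular_partP n (X : 'M[F]_n) s (A : 'M[F]_s) : A \in unitmx ->
  nonsingular_part X A <-> exists (V : 'M[F]_(n, s)) (k : nat) (W : 'M[F]_(s, n)),
    [/\ \rank V = s, X *m V = V *m A & X ^+ k = V *m W].
Proof.
move=> uA; split.
  move=> [t [V [V0 [N [[st rV] XV XV0 _ [k Nk]]]]]].
  have /row_freeP[P VP] : row_free (row_mx V V0) by rewrite /row_free rV.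
  exists V, k, (A ^+ k *m usubmx P); split => //.
    apply/eqP; rewrite eqn_leq rank_leq_col -(leq_add2r t) st -{1}rV.
    rewrite -mxrank_tr tr_row_mx -addsmxE.
    apply: leq_trans (mxrank_adds_leqif _ _) _.
    by rewrite !mxrank_tr leq_add2l rank_leq_col.
  rewrite -[LHS]mulmx1 -VP [LHS]mulmxA mul_mx_row (mulmx_exp _ XV) (mulmx_exp _ XV0).
  by rewrite Nk mulmx0 -{1}[P]vsubmxK mul_row_col mul0mx addr0 mulmxA.
move=> [V [k [W [rV XV XW]]]].
have uAk := unitmx_exp k uA.
have rXk : \rank (X ^+ k) = s.
  apply/eqP; rewrite eqn_leq {1}XW.
  rewrite (leq_trans (mxrankM_maxr _ _)) ?rank_leq_row //=.
  rewrite -{1}rV -(mxrankMfree V (B := A ^+ k)) ?row_free_unit //.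
  by rewrite -(mulmx_exp _ XV) mxrankM_maxl.
pose Y := (X ^+ k)^T; pose K := row_base (kermx Y).
pose t := \rank (kermx Y).
have KY p (B : 'M[F]_(p, n)) : (B <= K)%MS = (B *m Y == 0).
  by rewrite eq_row_base sub_kermx.
have XK : X ^+ k *m K^T = 0.
  by apply: trmx_inj; rewrite trmx_mul trmxK trmx0; apply/eqP; rewrite -KY.
have rK : \rank K^T = t.
  by rewrite mxrank_tr; apply/eqP; exact: row_base_free.
have st : (s + t = n)%N.
  by rewrite /t mxrank_ker /Y mxrank_tr rXk subnKC // -rXk rank_leq_row.
have /submxP[D DK] : (K *m X^T <= K)%MS.
  rewrite KY /Y -mulmxA -trmx_mul mulmxE -exprSr exprS -mulmxE trmx_mul mulmxA.
  by rewrite -[K]trmxK -trmx_mul XK trmx0 mul0mx.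
have XKD : X *m K^T = K^T *m D^T.
  by apply: trmx_inj; rewrite !trmx_mul !trmxK.
exists t, V, K^T, D^T; split => //.
  split=> //; rewrite -[RHS]st; apply: col_freeP => B.
  rewrite -[B]vsubmxK mul_row_col => VK0.
  have uB0 : usubmx B = 0.
    apply: (@col_free_inj _ _ _ (V *m A ^+ k)); last first.
      rewrite mulmx0 -(mulmx_exp _ XV) -mulmxA (canRL (addrK _) VK0) sub0r.
      by rewrite mulmxN mulmxA XK mul0mx oppr0.
    by rewrite mxrankMfree ?row_free_unit.
  move: VK0; rewrite uB0 mulmx0 add0r => KB0.
  have -> : dsubmx B = 0 by apply: (col_free_inj rK); rewrite KB0 mulmx0.
  by rewrite col_mx0.
exists k; apply: (col_free_inj rK); rewrite mulmx0 -(mulmx_exp _ XKD).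
by rewrite XK.
Qed.

Lemma nonsingular_part_unit n (X : 'M[F]_n) s (A : 'M[F]_s) :
  nonsingular_part X A -> A \in unitmx.
Proof. by case=> [t [V [V0 [N []]]]]. Qed.

Lemma nonsingular_part_ex n (X : 'M[F]_n) :
  exists s, exists A : 'M[F]_s, nonsingular_part X A.
Proof.
have [k kmin] : exists k, forall j, (\rank (X ^+ k) <= \rank (X ^+ j))%N.
  have exP : exists r, `[< exists k, \rank (X ^+ k) = r >].
    by exists (\rank (X ^+ 0)); apply/asboolP; exists 0%N.
  case: (ex_minnP exP) => r /asboolP[k <-] rmin; exists k => j.
  by apply: rmin; apply/asboolP; exists j.
pose V := col_base (X ^+ k); pose W := row_base (X ^+ k).
have VW : V *m W = X ^+ k by exact: mulmx_base.
have rV : \rank V = \rank (X ^+ k).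
  by apply/eqP; exact: col_base_full.
have fW : row_free W by exact: row_base_free.
have /row_freeP[R WR] := fW.
pose A := W *m X *m R.
have XVW : X *m V *m W = V *m (W *m X).
  by rewrite -mulmxA VW mulmxA VW !mulmxE -exprS -exprSr.
have XV : X *m V = V *m A by rewrite -[LHS]mulmx1 -WR [LHS]mulmxA XVW -!mulmxA.
have uA : A \in unitmx.
  rewrite -row_free_unit /row_free eqn_leq rank_leq_row /=.
  apply: leq_trans (kmin k.+1) _.
  have -> : X ^+ k.+1 = V *m A *m W by rewrite -XV -mulmxA VW mulmxE -exprS.
  by rewrite mxrankMfree // mxrankM_maxr.
exists (\rank (X ^+ k)), A; apply/(nonsingular_partP X uA).
by exists V, k, W.
Qed.

Lemma nonsingular_part_uniq n (X : 'M[F]_n) s (A : 'M[F]_s) s' (A' : 'M[F]_s')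
    (uA : A \in unitmx) (uA' : A' \in unitmx) :
  nonsingular_part X A -> nonsingular_part X A' ->
  class_of_unit uA = class_of_unit uA'.
Proof.
have absorb p q (B : 'M[F]_p) (C : 'M[F]_q) : B \in unitmx -> C \in unitmx ->
    forall (V : 'M[F]_(n, p)) (V' : 'M[F]_(n, q)) k W,
    X *m V = V *m B -> X ^+ k = V' *m W -> exists Q, V = V' *m Q.
  move=> uB _ V V' k W XV XW; exists (W *m V *m invmx (B ^+ k)).
  by rewrite !mulmxA -XW (mulmx_exp _ XV) mulmxK // unitmx_exp.
move=> /(nonsingular_partP _ uA)[V [k [W [rV XV XW]]]].
move=> /(nonsingular_partP _ uA')[V' [k' [W' [rV' XV' XW']]]].
have [Q VQ] := absorb _ _ _ _ uA uA' _ _ _ _ XV XW'.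
have [Q' VQ'] := absorb _ _ _ _ uA' uA _ _ _ _ XV' XW.
have ss' : s = s'.
  have : (\rank V <= \rank V')%N by rewrite {1}VQ mxrankM_maxl.
  have : (\rank V' <= \rank V)%N by rewrite {1}VQ' mxrankM_maxl.
  by rewrite rV rV' => ? ?; apply/eqP; rewrite eqn_leq; apply/andP.
case: s' / ss' => /= in A' uA' V' W' rV' XV' XW' Q Q' VQ VQ' *.
have QQ : Q *m Q' = 1%:M.
  by apply: (col_free_inj rV'); rewrite mulmxA -VQ -VQ' mulmx1.
have [uQ _] := mulmx1_unit QQ.
have QA : Q *m A = A' *m Q.
  by apply: (col_free_inj rV'); rewrite !mulmxA -VQ -XV -XV' -mulmxA -VQ.
have cE : conj_class A = conj_class A'.
  by apply/esym/conj_class_eq/conj_classP; exists Q.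
by rewrite /class_of_unit; congr Tagged; exact: val_inj.
Qed.

Lemma nonsingular_typeE n (X : 'M[F]_n) s (A : 'M[F]_s) (uA : A \in unitmx) :
  nonsingular_part X A -> nonsingular_type X = class_of_unit uA.
Proof.
move=> XA; apply: xget_unique.
  exists A => //=; apply/conj_classP; exists 1%:M; first exact: unitmx1.
  by rewrite mul1mx mulmx1.
move=> tau [B Btau XB]; have uB := nonsingular_part_unit XB.
rewrite (nonsingular_part_uniq uA uB XA XB).
case: tau B Btau XB uB => r [C /= Cr] B BC XB uB.
rewrite /class_of_unit; congr Tagged; apply: val_inj => /=.
by case/imsetP: Cr BC => D _ -> /conj_class_eq ->.
Qed.

Lemma nonsingular_part_block n (X : 'M[F]_n) (u : 'cV[F]_n) s (A : 'M[F]_s) :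
  nonsingular_part X A ->
  nonsingular_part (block_mx X u 0 0 : 'M[F]_(n + 1)) A.
Proof.
move=> XA; have uA := nonsingular_part_unit XA.
move: XA => /(nonsingular_partP _ uA)[V [k [W [rV XV XW]]]].
apply/(nonsingular_partP _ uA); exists (col_mx V 0), k.+1, (row_mx (W *m X) (W *m u)).
split.
- apply: col_freeP => B; rewrite mul_col_mx -[RHS]col_mx0 => /eq_col_mx[VB _].
  by apply: (col_free_inj rV); rewrite VB mulmx0.
- by rewrite mul_block_col mul_col_mx !mul0mx mulmx0 !addr0 XV.
rewrite mul_col_row !mul0mx !mulmxA -XW.
elim: {XW} k => [|k IH]; first by rewrite expr1 expr0 !mul1mx.
rewrite exprS IH -mulmxE mulmx_block !mulmx0 !mul0mx !addr0.
by rewrite !mulmxA mulmxE -exprS.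
Qed.

End NonsingularType.

Section StableType.
Context {F : finFieldType}.

Definition stable_type (M : Lq F) : Sigma F :=
  xget Sigma0
    [set tau | \forall n \near \oo, nonsingular_type (corner n (val M)) = tau].

Definition Lsigma (tau : Sigma F) : set (Lq F) :=
  [set M | stable_type M = tau].

Lemma corner_Lset n (M : infmx F) k s (A : 'M[F]_s) : Lset F n M ->
  nonsingular_part (corner n M) A -> nonsingular_part (corner (n + k) M) A.
Proof.
move=> LM XA; elim: k => [|k IH]; first by rewrite addn0.
rewrite addnS -addn1.
suff -> : corner (n + k + 1) M =
    block_mx (corner (n + k) M) (\col_i (M (val i, n + k)%N : F)) 0 0.
  exact: nonsingular_part_block.
apply/matrixP => i j; rewrite -[i]fintype.splitK -[j]fintype.splitK.
case: (fintype.split i) => i'; case: (fintype.split j) => j' /=.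
- by rewrite block_mxEul !mxE.
- by rewrite block_mxEur !mxE /= ord1 addn0.
- rewrite block_mxEdl !mxE /= ord1 addn0; apply: LM; last exact: leq_addr.
  exact: ltnW.
- by rewrite block_mxEdr !mxE /= !ord1 addn0; apply: LM => //; exact: leq_addr.
Qed.

Lemma nonsingular_type_corner n (M : infmx F) k : Lset F n M -> (n <= k)%N ->
  nonsingular_type (corner k M) = nonsingular_type (corner n M).
Proof.
move=> LM nk; have [s [A XA]] := nonsingular_part_ex (corner n M).
have uA := nonsingular_part_unit XA; rewrite (nonsingular_typeE uA XA).
by apply: nonsingular_typeE; rewrite -(subnKC nk); exact: corner_Lset.
Qed.

Lemma stable_typeE n (M : Lq F) : Lset F n (val M) ->
  stable_type M = nonsingular_type (corner n (val M)).
Proof.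
move=> LM; apply: xget_unique.
  by exists n => // k; exact: nonsingular_type_corner.
move=> tau [m _ Mtau]; rewrite -(Mtau (maxn m n)) /= ?leq_maxl //.
exact/nonsingular_type_corner/leq_maxr.
Qed.

Lemma open_corner n (P : 'M[F]_n -> Prop) :
  open [set M : infmx F | P (corner n M)].
Proof.
rewrite openE => M /= PM.
pose agree (ij : 'I_n * 'I_n) : set (infmx F) :=
  [set N | N (val ij.1, val ij.2) = M (val ij.1, val ij.2)].
have : \forall N \near M, forall ij, agree ij N.
  apply: (@filter_forall (infmx F) _ agree (nbhs M)) => ij.
  by apply: (@proj_continuous _ (fun=> discrete_topology F)
     (val ij.1, val ij.2) M [set M (val ij.1, val ij.2)]); exact: discrete_set1.
apply: filterS => N NM /=.
suff -> : corner n N = corner n M by [].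
by apply/matrixP => i j; rewrite !mxE; exact: (NM (i, j)).
Qed.

Lemma open_Lsigma (tau : Sigma F) : open (Lsigma tau).
Proof.
move=> n; exists [set M | nonsingular_type (corner n M) = tau].
  exact: (open_corner (fun X => nonsingular_type X = tau)).
by apply/seteqP; split => M; rewrite /Lsigma /= (stable_typeE (n := n)) //;
  exact: set_mem (valP M).
Qed.

Lemma measurable_Lsigma (tau : Sigma F) : measurable (Lsigma tau).
Proof. by apply: sub_sigma_algebra; exact: open_Lsigma. Qed.

End StableType.

(* A {measure set T -> \bar R} is a function on all sets, constrained on the
   measurable ones only.  To make equality of such objects coincide with
   equality of Borel measures, we represent a Borel measure by the
   {measure set T -> \bar R} that takes the value 0 on non-measurable sets. *)
Definition normalized d (T : measurableType d) (R : realType)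
    (P : {measure set T -> \bar R}) : Prop :=
  forall A : set T, ~ measurable A -> P A = 0%E.

Definition borel_restr d (T : measurableType d) (R : realType)
    (P : {measure set T -> \bar R}) (D : set T) (mD : measurable D)
    (A : set T) : \bar R :=
  if `[< measurable A >] then mrestr P mD A else 0%E.

Section BorelRestr.
Context d (T : measurableType d) (R : realType).
Variables (P : {measure set T -> \bar R}) (D : set T) (mD : measurable D).
Local Open Scope ereal_scope.

Lemma borel_restrE (A : set T) : measurable A ->
  borel_restr P mD A = P (A `&` D).
Proof. by move=> mA; rewrite /borel_restr asboolT. Qed.

Let borel_restr0 : borel_restr P mD set0 = 0.
Proof. by rewrite borel_restrE // set0I measure0. Qed.

Let borel_restr_ge0 A : 0 <= borel_restr P mD A.
Proof. by rewrite /borel_restr; case: ifP => // _; exact: measure_ge0. Qed.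

Let borel_restr_sigma_additive : semi_sigma_additive (borel_restr P mD).
Proof.
move=> U mU tU mUU; rewrite borel_restrE //.
rewrite (_ : (fun n => _) = fun n => \sum_(0 <= i < n) mrestr P mD (U i)).
  exact: (@measure_semi_sigma_additive _ _ _ (mrestr P mD)).
by apply/funext => n; apply: eq_bigr => i _; rewrite borel_restrE.
Qed.

HB.instance Definition _ := isMeasure.Build _ _ _ (borel_restr P mD)
  borel_restr0 borel_restr_ge0 borel_restr_sigma_additive.

End BorelRestr.

Definition affine_isomorphism (R : realType) (X Y : Type)
    (addX : X -> X -> X) (scaleX : {nonneg R} -> X -> X)
    (addY : Y -> Y -> Y) (scaleY : {nonneg R} -> Y -> Y)
    (C : set X) (D : set Y) (f : X -> Y) : Prop :=
  [/\ set_bij C D f,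
      forall x y, C x -> C y -> f (addX x y) = addY (f x) (f y) &
      forall c x, C x -> f (scaleX c x) = scaleY c (f x)].

Section Cones.
Context {R : realType} {F : finFieldType}.

Definition Lmeasure : Type := {measure set (Lq F) -> \bar R}.

Definition Lmeasure_add (P Q : Lmeasure) : Lmeasure := measure_add P Q.
Definition Lmeasure_scale (c : {nonneg R}) (P : Lmeasure) : Lmeasure := mscale c P.

Definition radon (P : Lmeasure) : Prop :=
  forall K : set (Lq F), compact K -> (P K < +oo)%E.

Definition GLinf_invariant (P : Lmeasure) : Prop :=
  forall (n : nat) (g : 'M[F]_n), g \in unitmx ->
  forall A : set (Lq F), measurable A -> P (Lconj g @^-1` A) = P A.

Definition inv_cone : set Lmeasure :=
  [set P | [/\ normalized P, radon P & GLinf_invariant P]].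

Definition inv_cone_at (tau : Sigma F) : set Lmeasure :=
  [set P | inv_cone P /\ P (~` Lsigma tau) = 0%E].

Definition inv_cone_prod : set (Sigma F -> Lmeasure) :=
  [set Q | forall tau, inv_cone_at tau (Q tau)].

Definition prod_add (Q Q' : Sigma F -> Lmeasure) : Sigma F -> Lmeasure :=
  fun tau => Lmeasure_add (Q tau) (Q' tau).
Definition prod_scale (c : {nonneg R}) (Q : Sigma F -> Lmeasure) :
    Sigma F -> Lmeasure :=
  fun tau => Lmeasure_scale c (Q tau).

Definition restr (P : Lmeasure) : Sigma F -> Lmeasure :=
  fun tau => borel_restr P (measurable_Lsigma tau).

Lemma Lmeasure_addE P Q A : Lmeasure_add P Q A = (P A + Q A)%E.
Proof. exact: measure_addE. Qed.

Lemma inv_coneD P Q : inv_cone P -> inv_cone Q -> inv_cone (Lmeasure_add P Q).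
Proof.
move=> [nP rP iP] [nQ rQ iQ]; split=> [A nA|K cK|n g ug A mA].
- by rewrite Lmeasure_addE nP // nQ // adde0.
- by rewrite Lmeasure_addE lte_add_pinfty ?rP ?rQ.
- by rewrite !Lmeasure_addE iP // iQ.
Qed.

Lemma inv_coneZ (c : {nonneg R}) P : inv_cone P -> inv_cone (Lmeasure_scale c P).
Proof.
move=> [nP rP iP]; split=> [A nA|K cK|n g ug A mA].
- by rewrite /= /mscale nP // mule0.
- by rewrite /= /mscale lte_mul_pinfty ?rP // lee_fin.
- by rewrite /= /mscale iP.
Qed.

Lemma inv_cone_atD tau P Q : inv_cone_at tau P -> inv_cone_at tau Q ->
  inv_cone_at tau (Lmeasure_add P Q).
Proof.
move=> [cP P0] [cQ Q0]; split; first exact: inv_coneD.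
by rewrite Lmeasure_addE P0 Q0 adde0.
Qed.

Lemma inv_cone_atZ tau (c : {nonneg R}) P : inv_cone_at tau P ->
  inv_cone_at tau (Lmeasure_scale c P).
Proof.
move=> [cP P0]; split; first exact: inv_coneZ.
by rewrite /= /mscale P0 mule0.
Qed.

End Cones.

Arguments Lmeasure : clear implicits.
Arguments inv_cone : clear implicits.
Arguments inv_cone_prod : clear implicits.

(* Main.v *)
Require Import Defs.
From HB Require Import structures.
From mathcomp Require Import all_boot all_order all_algebra.
From mathcomp Require Import all_classical all_reals all_analysis.
Import Order.TTheory GRing.Theory Num.Theory.
Local Open Scope classical_set_scope.
Local Open Scope ring_scope.

(** The stable type is conjugation invariant, because conjugation by
    [g] in GL(n, q) acts on every corner of size at least [n] by conjugation
    by [diag(g, 1)]; hence the restriction of an invariant measure to a piece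
    is invariant.  The pieces are countably many, pairwise disjoint and
    measurable, so a measure is the sum of its restrictions, which gives
    injectivity.  Conversely, the sum of any family of Radon measures supported
    on the respective pieces is Radon: the pieces are open, so a compact set
    meets only finitely many of them. *)

(** * Sums and measures indexed by a countable type *)

Section EsumCountable.
Context {R : realType} {I : countType}.
Implicit Type a : I -> \bar R.
Local Open Scope ereal_scope.

(** Turns a sum over [I] into a series over the naturals, the form used by sigma-additivity and
    [mseries]; a natural number that encodes no element of [I] contributes the default 0. *)
Lemma nneseries_pickle_inv a : (forall i, 0 <= a i) ->
  \sum_(0 <= n <oo) oapp a 0 (pickle_inv n) = \esum_(i in [set: I]) a i.
Proof.
move=> a0; rewrite nneseries_esumT => [|n]; last by case: pickle_inv => /=.
transitivity (\esum_(n in range (@pickle I)) oapp a 0 (pickle_inv n)).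
  rewrite [RHS]esum_mkcond; apply: eq_esum => n _.
  case: ifPn => // /negP nI; case E : (pickle_inv n) => [i|//]; case: nI.
  apply/mem_set; exists i => //.
  by have := @pickle_invK I n; rewrite /ocancel E.
rewrite (reindex_esum setT _ (@pickle I)); last first.
  split=> [i _|i j _ _ /(pcan_inj pickleK)//|n [i _ <-]]; by exists i.
by apply: eq_esum => i _; rewrite pickleK_inv.
Qed.

Lemma esum_supp (S : set I) a : (forall i, ~ S i -> a i = 0) ->
  \esum_(i in [set: I]) a i = \esum_(i in S) a i.
Proof.
move=> aS; rewrite [RHS]esum_mkcond; apply: eq_esum => i _.
by case: ifPn => // /negP iS; apply: aS => Si; apply/iS/mem_set.
Qed.

Context {d} {T : measurableType d}.

(** Sigma-additivity along the sequence of pieces of [A] listed by code, padded with the empty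
    set. *)
Lemma measure_esum_partition (mu : {measure set T -> \bar R}) (D : I -> set T) :
    (forall i, measurable (D i)) -> trivIset setT D -> \bigcup_i D i = setT ->
  forall A, measurable A -> mu A = \esum_(i in [set: I]) mu (A `&` D i).
Proof.
move=> mD tD cD A mA.
pose E n := oapp (fun i => A `&` D i) set0 (pickle_inv n).
have mE n : measurable (E n).
  by rewrite /E; case: pickle_inv => [i|] //=; exact: measurableI.
have tE : trivIset setT E.
  move=> m n _ _; rewrite /E.
  case Em : (pickle_inv m) => [i|]; case En : (pickle_inv n) => [j|] /= [x];
    rewrite ?setI0 ?set0I //.
  (* A common point forces the two indices to agree, and the index determines its code. *)
  move=> [[_ xi] [_ xj]].
  have ij : i = j by apply: tD => //; exists x.
  have := @pickle_invK I m; rewrite /ocancel Em /= => <-.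
  by have := @pickle_invK I n; rewrite /ocancel En /= => <-; rewrite ij.
have -> : mu A = mu (\bigcup_n E n).
  congr (mu _); apply/seteqP; split=> [x Ax|x [n _]]; last first.
    by rewrite /E; case: pickle_inv => [i|//] [].
  have [i _ xi] : (\bigcup_i D i) x by rewrite cD.
  by exists (pickle i) => //; rewrite /E pickleK_inv.
rewrite measure_semi_bigcup //; last exact: bigcup_measurable.
rewrite -nneseries_pickle_inv //; apply: eq_eseriesr => n _.
by rewrite /E; case: pickle_inv => //=; rewrite measure0.
Qed.

(** Listing the family by code, padded with the zero measure, makes the sum an instance of
    [mseries], hence a measure. *)
Definition msum_countable (m : I -> {measure set T -> \bar R}) :
    {measure set T -> \bar R} :=
  mseries (fun n => oapp m mzero (pickle_inv n)) 0.

Lemma msum_countableE m A : msum_countable m A = \esum_(i in [set: I]) m i A.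
Proof.
rewrite -nneseries_pickle_inv //= /mseries; apply: eq_eseriesr => n _.
by case: pickle_inv.
Qed.

End EsumCountable.

(** * Continuity of conjugation and invariance of the stable type *)

Lemma continuous_prod_topology (X : topologicalType) (I : Type)
    (K : I -> topologicalType) (f : X -> prod_topology K) :
  (forall i, continuous (fun x => f x i : K i)) -> continuous f.
Proof.
move=> cf x; apply/cvg_sup => i U [V [[W oW <-] Wfx]] /filterS; apply.
by apply: (cf i x); exact: open_nbhs_nbhs.
Qed.

Section Conjugation.
Context {F : finFieldType}.
Implicit Type M : infmx F.

Lemma diag_embed0r n (g : 'M[F]_n) N i k :
  (n <= N)%N -> (i < N)%N -> (N <= k)%N -> diag_embed g (i, k) = 0 :> F.
Proof.
move=> nN iN Nk; rewrite /diag_embed /= [insub k]insubF; last first.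
  by rewrite ltnNge (leq_trans nN Nk).
by case: insub => [?|]; rewrite ltn_eqF // (leq_trans iN).
Qed.

Lemma diag_embed0l n (g : 'M[F]_n) N k j :
  (n <= N)%N -> (j < N)%N -> (N <= k)%N -> diag_embed g (k, j) = 0 :> F.
Proof.
move=> nN jN Nk; rewrite /diag_embed /= [insub k]insubF; last first.
  by rewrite ltnNge (leq_trans nN Nk).
by rewrite gtn_eqF // (leq_trans jN).
Qed.

(** For [n <= N], [diag_embed g] is block diagonal with respect to the cut at [N], so no index
    beyond [N] enters the corner of the product. *)
Lemma corner_infmul_diagl n (g : 'M[F]_n) N M : (n <= N)%N ->
  corner N (infmul (diag_embed g) M) = corner N (diag_embed g) *m corner N M.
Proof.
move=> nN; apply/matrixP => i j; rewrite !mxE (@infmul_ord _ N).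
  by apply: eq_bigr => k _; rewrite !mxE.
by move=> k Nk; rewrite (@diag_embed0r _ _ N) ?mul0r ?ltn_ord.
Qed.

Lemma corner_infmul_diagr n (g : 'M[F]_n) N M : (n <= N)%N ->
  corner N (infmul M (diag_embed g)) = corner N M *m corner N (diag_embed g).
Proof.
move=> nN; apply/matrixP => i j; rewrite !mxE (@infmul_ord _ N).
  by apply: eq_bigr => k _; rewrite !mxE.
by move=> k Nk; rewrite (@diag_embed0l _ _ N) ?mulr0 ?ltn_ord.
Qed.

Lemma corner_infconj n (g : 'M[F]_n) N M : (n <= N)%N ->
  corner N (infconj g M) =
  corner N (diag_embed g) *m corner N M *m corner N (diag_embed (invmx g)).
Proof. by move=> nN; rewrite corner_infmul_diagr // corner_infmul_diagl. Qed.

Lemma corner_diag_embedV n (g : 'M[F]_n) N : (n <= N)%N -> g \in unitmx ->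
  corner N (diag_embed g) *m corner N (diag_embed (invmx g)) = 1%:M.
Proof.
move=> nN ug; rewrite -corner_infmul_diagl //; apply/matrixP => i j.
rewrite !mxE infmul_diagl; case: insubP => [i' _ i'i|ni] /=; last first.
  by rewrite /diag_embed /= insubN.
(* Here [i < n]. For [j >= n] both sides vanish; for [j < n] the entry is one of [g *m invmx g]. *)
case: (ltnP j n) => [jn|nj]; last first.
  rewrite big1 => [|k _]; last by rewrite (@diag_embed0r _ _ n) ?mulr0.
  by case: eqP => // ij; move: nj; rewrite -ij -i'i leqNgt ltn_ord.
have -> : (i == j) = (i' == Ordinal jn) by rewrite -!val_eqE /= i'i.
have <- : (1%:M : 'M[F]_n) i' (Ordinal jn) = (i' == Ordinal jn)%:R by rewrite mxE.
rewrite -(mulmxV ug) mxE.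
apply: eq_bigr => k _; rewrite /diag_embed /= valK (insubT (fun x => x < n)%N jn).
by [].
Qed.

(** Multiplying the bases of both invariant subspaces by [G] leaves the matrices of the two
    restrictions unchanged. *)
Lemma nonsingular_type_conj N (X G G' : 'M[F]_N) : G *m G' = 1%:M ->
  nonsingular_type (G *m X *m G') = nonsingular_type X.
Proof.
move=> GG'; have G'G := mulmx1C GG'.
have [s [A XA]] := nonsingular_part_ex X.
have uA := nonsingular_part_unit XA; rewrite (nonsingular_typeE uA XA).
apply: nonsingular_typeE; have [uG _] := mulmx1_unit GG'.
move: XA => [t [V [V0 [B [[st rV] XV XV0 _ nB]]]]].
exists t, (G *m V), (G *m V0), B; split=> //.
- split=> //; rewrite -mul_mx_row.
  by have := uG; rewrite -row_full_unit => /eqmxMfull ->.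
- by rewrite -!mulmxA (mulmxA G') G'G mul1mx XV.
- by rewrite -!mulmxA (mulmxA G') G'G mul1mx XV0.
Qed.

Lemma stable_type_Lconj n (g : 'M[F]_n) (M : Lq F) : g \in unitmx ->
  stable_type (Lconj g M) = stable_type M.
Proof.
move=> ug; have [m LM] := LsetP M.
(* The size [maxn m n] is large enough both for the conjugate to have reached its stable type and
   for its corner to be a matrix conjugate. *)
rewrite (stable_typeE (n := maxn m n)); last exact: infconj_Lset.
rewrite corner_infconj ?leq_maxr // nonsingular_type_conj; last first.
  by rewrite corner_diag_embedV ?leq_maxr.
by rewrite (stable_typeE LM); apply: nonsingular_type_corner => //; exact: leq_maxl.
Qed.

Lemma preimage_Lconj_Lsigma n (g : 'M[F]_n) tau : g \in unitmx ->
  Lconj g @^-1` Lsigma tau = Lsigma tau.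
Proof.
by move=> ug; apply/seteqP; split=> M; rewrite /Lsigma /= stable_type_Lconj.
Qed.

Lemma infconj_continuous n (g : 'M[F]_n) : continuous (@infconj F n g).
Proof.
apply: (@continuous_prod_topology (infmx F) _ (fun=> discrete_topology F)) => -[i j].
apply/continuousP => A _.
(* The entry at [(i, j)] depends only on the corner of size [N]: the successor makes [i] and [j]
   valid indices, and [n <= N] lets conjugation restrict to the corner. *)
pose N := maxn n (maxn i j).+1.
have iN : (i < N)%N by rewrite leq_max ltnS leq_maxl orbT.
have jN : (j < N)%N by rewrite leq_max ltnS leq_maxr orbT.
pose P (X : 'M[F]_N) := A ((corner N (diag_embed g) *m X *m
  corner N (diag_embed (invmx g))) (Ordinal iN) (Ordinal jN)).
suff -> : (fun M : infmx F => infconj g M (i, j)) @^-1` A =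
    [set M | P (corner N M)] by exact: open_corner.
by apply/seteqP; split=> L; rewrite /P /= -corner_infconj ?leq_maxl // mxE.
Qed.

Lemma Lconj_continuous n (g : 'M[F]_n) : continuous (@Lconj F n g).
Proof.
apply/continuousP => U oU; suff : Lopen (Lconj g @^-1` U) by [].
(* Conjugation sends [Lset F m] into [Lset F (maxn m n)], where [U] is the trace of an open set [V]
   of infinite matrices; continuity of [infconj] pulls [V] back. *)
move=> m; have [V oV VU] := oU (maxn m n).
exists (infconj g @^-1` V).
  by move: V oV {VU}; apply/continuousP; exact: infconj_continuous.
suff VUg (M : set_type (Lset F m)) :
    V (infconj g (val M)) <-> U (Lconj g (Lincl M)).
  by apply/seteqP; split=> M /VUg.
have LM := infconj_Lset g (set_mem (valP M)).
pose M' : set_type (Lset F (maxn m n)) :=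
  exist (fun x => x \in Lset F (maxn m n)) _ (mem_set LM).
have -> : Lconj g (Lincl M) = Lincl M' by exact: val_inj.
by rewrite -[U _]/((@Lincl F (maxn m n) @^-1` U) M') -VU.
Qed.

Lemma measurable_preimage_Lconj n (g : 'M[F]_n) (A : set (Lq F)) :
  measurable A -> measurable (Lconj g @^-1` A).
Proof.
move=> mA; rewrite -[X in measurable X]setTI.
suff : measurable_fun setT (@Lconj F n g) by apply.
apply: (measurability (@open (Lq F))) => [//|_ [U oU <-]].
rewrite setTI; apply: sub_sigma_algebra.
by move: U oU; apply/continuousP; exact: Lconj_continuous.
Qed.

End Conjugation.

(** * Restriction to the pieces and summation over them *)

Section Decomposition.
Context {R : realType} {F : finFieldType}.
Implicit Types (P Q : Lmeasure R F) (A : set (Lq F)).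
Local Open Scope ereal_scope.

Lemma Lmeasure_eq P Q : normalized P -> normalized Q ->
  (forall A, measurable A -> P A = Q A) -> P = Q.
Proof.
move=> nP nQ PQ; apply: eq_measure; apply/funext => A.
by have [/PQ//|nA] := pselect (measurable A); rewrite nP // nQ.
Qed.

Lemma restr_normalized P tau : normalized (restr P tau).
Proof. by move=> A nA; rewrite /restr /= /borel_restr asboolF. Qed.

Lemma restrE P tau A : measurable A -> restr P tau A = P (A `&` Lsigma tau).
Proof. exact: borel_restrE. Qed.

Lemma measure_esum_restr P A : measurable A ->
  P A = \esum_(tau in [set: Sigma F]) restr P tau A.
Proof.
move=> mA; rewrite (@measure_esum_partition _ _ _ _ P (@Lsigma F)) //.
- by apply: eq_esum => tau _; rewrite restrE.
- exact: measurable_Lsigma.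
- by move=> s t _ _ [M [/= <- <-]].
- by apply/seteqP; split=> M // _; exists (stable_type M).
Qed.

Lemma restr_inv_cone_at P tau : inv_cone R F P -> inv_cone_at tau (restr P tau).
Proof.
move=> [nP rP iP]; split; last first.
  rewrite restrE; last exact: measurableC (measurable_Lsigma tau).
  by rewrite setICl measure0.
split=> [|K cK|n g ug A mA]; first exact: restr_normalized.
(* [radon] ranges over all compact sets; on a non-measurable one the restriction is 0 by
   convention. *)
- have [mK|nK] := pselect (measurable K); last by rewrite restr_normalized.
  rewrite restrE //; apply: le_lt_trans (rP _ cK).
  apply: le_measure; rewrite ?inE //.
  by apply: measurableI => //; exact: measurable_Lsigma.
- rewrite !restrE //; last exact: measurable_preimage_Lconj.
  (* The piece is its own preimage, so intersecting with it commutes with taking preimages. *)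
  rewrite -{1}(preimage_Lconj_Lsigma n g tau ug) -preimage_setI iP //.
  by apply: measurableI => //; exact: measurable_Lsigma.
Qed.

Lemma compact_finite_Lsigma (K : set (Lq F)) : compact K ->
  exists2 S : set (Sigma F), finite_set S &
    forall tau, ~ S tau -> K `<=` ~` Lsigma tau.
Proof.
rewrite compact_cover => /(_ _ setT (@Lsigma F)).
case=> [tau _|M _|D _]; first exact: open_Lsigma.
  by exists (stable_type M).
set S := (X in cover X _) => KS; exists S; first exact: finite_fset.
(* A point of [K] has its stable type among the indices [S] of the finite subcover. *)
by move=> tau nS M /KS[s Ss Ms] Mtau; apply: nS; rewrite -Mtau Ms.
Qed.

Lemma inv_cone_at_notin tau P A : inv_cone_at tau P -> measurable A ->
  A `<=` ~` Lsigma tau -> P A = 0.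
Proof.
move=> [_ P0] mA A0; apply/eqP; rewrite eq_le measure_ge0 andbT -P0.
apply: le_measure; rewrite ?inE //.
exact: measurableC (measurable_Lsigma tau).
Qed.

Lemma msum_inv_cone (Q : Sigma F -> Lmeasure R F) :
  inv_cone_prod R F Q -> inv_cone R F (msum_countable Q).
Proof.
move=> cQ; have nQ tau : normalized (Q tau) by have [[]] := cQ tau.
have nP : normalized (msum_countable Q).
  by move=> A nA; rewrite msum_countableE esum1 // => tau _; exact: nQ.
split=> // [K cK|n g ug A mA].
- have [mK|/nP->//] := pselect (measurable K).
  have [S fS KS] := compact_finite_Lsigma _ cK.
  (* Outside [S] the terms vanish, since [K] misses the piece carrying [Q tau]; a finite sum of
     finite values remains. *)
  rewrite msum_countableE (@esum_supp _ _ S) => [|tau /KS Ktau]; last first.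
    exact: inv_cone_at_notin _ _ _ (cQ tau) mK Ktau.
  rewrite esum_fset // fsbig_finite //=; apply: lte_sum_pinfty => tau _.
  by have [[_ rQ _] _] := cQ tau; exact: rQ.
- rewrite !msum_countableE; apply: eq_esum => tau _.
  by have [[_ _ iQ] _] := cQ tau; exact: iQ.
Qed.

Lemma restr_msum (Q : Sigma F -> Lmeasure R F) :
  inv_cone_prod R F Q -> restr (msum_countable Q) = Q.
Proof.
move=> cQ; apply/funext => tau; have [[nQ _ _] _] := cQ tau.
apply: Lmeasure_eq => // [|A mA]; first exact: restr_normalized.
have mAs (s : Sigma F) : measurable (A `&` Lsigma s).
  by apply: measurableI => //; exact: measurable_Lsigma.
(* Only the [tau] term survives on a subset of [Lsigma tau], as the pieces are disjoint. *)
rewrite restrE // msum_countableE (@esum_supp _ _ [set tau]) => [|s st].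
  rewrite esum_set1 //.
  (* The part of [A] off the piece is null for [Q tau]. *)
  have QD : Q tau A = Q tau (A `\` Lsigma tau) + Q tau (A `&` Lsigma tau).
    exact: measureDI mA (measurable_Lsigma tau).
  rewrite QD (inv_cone_at_notin tau (Q tau) _ (cQ tau)) ?add0e //.
  by apply: measurableD => //; exact: measurable_Lsigma.
apply: (inv_cone_at_notin s _ _ (cQ s) (mAs tau)) => M [_ Mt] Ms; apply: st.
by rewrite /= -Mt -Ms.
Qed.

End Decomposition.

Theorem proposition5p4 (R : realType) (F : finFieldType) :
  affine_isomorphism Lmeasure_add Lmeasure_scale prod_add prod_scale
    (inv_cone R F) (inv_cone_prod R F) restr /\
  (forall P : Lmeasure R F, inv_cone R F P ->
     forall A : set (Lq F), measurable A ->
       P A = (\esum_(tau in [set: Sigma F]) restr P tau A)%E).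
Proof.
split; last by move=> P _ A; exact: measure_esum_restr.
split.
- split=> [P cP tau|P Q /set_mem[nP _ _] /set_mem[nQ _ _] PQ|Q cQ].
  + exact: restr_inv_cone_at.
  (* Injectivity: each measure is recovered as the sum of its restrictions. *)
  + apply: Lmeasure_eq => // A mA.
    by rewrite [LHS]measure_esum_restr // PQ -measure_esum_restr.
  + exists (msum_countable Q); [exact: msum_inv_cone|exact: restr_msum].
- move=> P Q [nP _ _] [nQ _ _]; apply/funext => tau; apply: eq_measure.
  apply/funext => A; rewrite [RHS]Lmeasure_addE.
  (* Equality is required on all sets; on non-measurable ones both sides are 0. *)
  have [mA|nA] := pselect (measurable A); last by rewrite !restr_normalized ?adde0.
  by rewrite !restrE // Lmeasure_addE.
- move=> c P _; apply/funext => tau; apply: eq_measure; apply/funext => A.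
  rewrite [RHS]/= /mscale /=.
  have [mA|nA] := pselect (measurable A); last by rewrite !restr_normalized ?mule0.
  by rewrite !restrE.
Qed.
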